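(* Let $\mathcal{G}=[V,A,B]$ be a dicot with positive vertex weights $x(v)$, positive solid-edge weights $a(v,v')$, positive dashed-edge weights $b(v,v')$, and an orientation $\mathcal{O}$ of its solid edges. Then the partition function of the monopole-dimer model on $\mathcal{G}$ satisfies \[ \mathcal{Z}(\mathcal{G}) = \det \mathcal{K}(\mathcal{G}), \] where $\mathcal{K}(\mathcal{G})$ is the complex adjacency matrix of $\mathcal{G}$ (rows and columns indexed by $V$ in any common order).
   Context: A dicot $\mathcal{G}=[V,A,B]$ consists of a finite vertex set $V$ and two sets $A$ (''solid'' edges) and $B$ (''dashed'' edges) of unordered pairs of distinct vertices of $V$, such that the multigraph $[V,A\cup B]$ is bipartite. Thus $[V,A]$ and $[V,B]$ are simple graphs, and two vertices are joined by at most one solid and at most one dashed edge. An orientation $\mathcal{O}$ assigns a direction to each solid edge; we write $v\to v'$ if the solid edge $\{v,v'\}$ is directed from $v$ to $v'$. A loop is a cyclic sequence $\ell=(v_1,\dots,v_{2m})$ ($m\ge 1$) of distinct vertices, considered up to cyclic rotation and traversed in the order $v_1\to v_2\to\cdots\to v_{2m}\to v_1$, together with a choice for each $j$ of an edge $e_j$ (solid or dashed) of $\mathcal{G}$ joining $v_j$ and $v_{j+1}$ (indices mod $2m$). For $m=1$ this is a doubled edge $v_1\to v_2\to v_1$; for $m\ge 2$ the two directions of traversal give different loops. A monopole-dimer configuration of $\mathcal{G}$ is a collection of pairwise vertex-disjoint loops, each containing an even number of dashed edges among $e_1,\dots,e_{2m}$; the vertices not on any loop are called isolated vertices. The weight of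 a loop is \[ w(\ell) = -\prod_{j=1}^{2m} c_j,\quad c_j=\begin{cases} a(v_j,v_{j+1}) & e_j \text{ solid and } v_j\to v_{j+1},\\ -a(v_j,v_{j+1}) & e_j\text{ solid and } v_{j+1}\to v_j,\\ \mathrm{i}\, b(v_j,v_{j+1}) & e_j \text{ dashed},\end{cases} \] with $\mathrm{i}=\sqrt{-1}$. The weight of a configuration is the product of the weights of its loops times the product of $x(w)$ over its isolated vertices $w$. The partition function $\mathcal{Z}(\mathcal{G})$ is the sum of the weights of all monopole-dimer configurations. The complex adjacency matrix $\mathcal{K}(\mathcal{G})$ is indexed by $V$ with entries $\mathcal{K}_{v,v}=x(v)$, $\mathcal{K}_{v,v'}=a(v,v')+\mathrm{i}\,b(v,v')$ if $v\to v'$, $\mathcal{K}_{v,v'}=-a(v,v')+\mathrm{i}\,b(v,v')$ if $v'\to v$, where $a(v,v')$ (resp. $b(v,v')$) is taken to be $0$ if there is no solid (resp. dashed) edge between $v$ and $v'$ (in particular when there is no solid edge, the entry is $\mathrm{i}\,b(v,v')$). *)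

(* Defs.v *)
From mathcomp Require Import all_boot all_order all_algebra.
From mathcomp Require Import reals complex.

Set Implicit Arguments.
Unset Strict Implicit.
Unset Printing Implicit Defensive.

Import Order.TTheory GRing.Theory Num.Theory.

Local Open Scope ring_scope.
Local Open Scope complex_scope.

(* An unordered pair {u, v} is the set [set u; v]; as a pair of distinct
   vertices it has cardinal 2, which rules out u = v. *)
Record dicot (V : finType) := Dicot {
  solid : {set {set V}};
  dashed : {set {set V}};
  card_solid : forall e, e \in solid -> #|e| = 2;
  card_dashed : forall e, e \in dashed -> #|e| = 2;
  dicot_bipartite : exists col : V -> bool,
    forall u v, [set u; v] \in solid :|: dashed -> col u != col v
}.

(* O u v means u -> v. *)
Record is_orientation (V : finType) (G : dicot V) (O : rel V) : Prop :=
  IsOrientation {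
    orient_solid : forall u v, O u v -> [set u; v] \in solid G;
    orient_one : forall u v, [set u; v] \in solid G -> O u v = ~~ O v u
  }.

(* The edge kind is a boolean, true for dashed and false for solid. *)
Definition edges (V : finType) (G : dicot V) (k : bool) : {set {set V}} :=
  if k then dashed G else solid G.

(* A sequence (v_1, e_1), ..., (v_n, e_n), where e_j is the kind of the edge
   joining v_j to v_(j+1), indices mod n.  The bound #|V| on n loses nothing,
   the v_j being distinct in a loop; it makes this a finite type. *)
Definition labelled_seq (V : finType) := {bseq #|V| of V * bool}.

Definition seq_vertices (V : finType) (s : seq (V * bool)) : seq V :=
  [seq p.1 | p <- s].

(* [next] is cyclic: the successor of the last vertex is the first one. *)
Definition is_loop_seq (V : finType) (G : dicot V) (s : seq (V * bool)) : bool :=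
  [&& (0 < size s)%N, ~~ odd (size s), uniq (seq_vertices s)
    & all (fun p => [set p.1; next (seq_vertices s) p.1] \in edges G p.2) s].

Definition rotations (V : finType) (s : labelled_seq V)
    : {set labelled_seq V} :=
  [set [bseq of rot (i : 'I_#|V|) s] | i : 'I_#|V|].

(* A loop is a class of labelled sequences up to cyclic rotation. *)
Definition is_loop (V : finType) (G : dicot V) (L : {set labelled_seq V})
    : bool :=
  [exists s : labelled_seq V, is_loop_seq G s && (L == rotations s)].

Definition loop_vertices (V : finType) (L : {set labelled_seq V}) : {set V} :=
  \bigcup_(s in L) [set v in seq_vertices s].

Definition num_dashed (V : finType) (s : seq (V * bool)) : nat :=
  count (fun p => p.2) s.

Definition even_dashed (V : finType) (L : {set labelled_seq V}) : bool :=
  [forall s in L, ~~ odd (num_dashed s)].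

Definition is_config (V : finType) (G : dicot V)
    (C : {set {set labelled_seq V}}) : bool :=
  [forall L in C, is_loop G L && even_dashed L] &&
  [forall L in C, forall L' in C,
     (L != L') ==> [disjoint loop_vertices L & loop_vertices L']].

Definition isolated (V : finType) (C : {set {set labelled_seq V}}) : {set V} :=
  ~: \bigcup_(L in C) loop_vertices L.

(* The factor c_j of an edge of kind k traversed from u to v.  Edge weights are
   functions of the unordered pair, hence symmetric. *)
Definition step_weight (R : realType) (V : finType) (O : rel V)
    (a b : {set V} -> R) (u : V) (k : bool) (v : V) : R[i] :=
  if k then 'i%C * (b [set u; v])%:C
  else if O u v then (a [set u; v])%:C else - (a [set u; v])%:C.

Definition seq_weight (R : realType) (V : finType) (O : rel V)
    (a b : {set V} -> R) (s : seq (V * bool)) : R[i] :=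
  - \prod_(p <- s) step_weight O a b p.1 p.2 (next (seq_vertices s) p.1).

(* Any representative may be used: see [loop_weightE]. *)
Definition loop_weight (R : realType) (V : finType) (O : rel V)
    (a b : {set V} -> R) (L : {set labelled_seq V}) : R[i] :=
  if [pick s in L] is Some s then seq_weight O a b s else 1.

Definition config_weight (R : realType) (V : finType) (O : rel V)
    (x : V -> R) (a b : {set V} -> R) (C : {set {set labelled_seq V}}) : R[i] :=
  (\prod_(L in C) loop_weight O a b L) * \prod_(v in isolated C) (x v)%:C.

Definition partition_function (R : realType) (V : finType) (G : dicot V)
    (O : rel V) (x : V -> R) (a b : {set V} -> R) : R[i] :=
  \sum_(C : {set {set labelled_seq V}} | is_config G C)
    config_weight O x a b C.

Definition solid_entry (R : realType) (V : finType) (O : rel V)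
    (a : {set V} -> R) (u v : V) : R :=
  if O u v then a [set u; v] else if O v u then - a [set u; v] else 0.

Definition dashed_entry (R : realType) (V : finType) (G : dicot V)
    (b : {set V} -> R) (u v : V) : R :=
  if [set u; v] \in dashed G then b [set u; v] else 0.

Definition adjacency_entry (R : realType) (V : finType) (G : dicot V)
    (O : rel V) (x : V -> R) (a b : {set V} -> R) (u v : V) : R[i] :=
  if u == v then (x u)%:C
  else (solid_entry O a u v)%:C + 'i%C * (dashed_entry G b u v)%:C.

(* The complex adjacency matrix for the ordering f of the vertices. *)
Definition adjacency_matrix (R : realType) (V : finType) (G : dicot V)
    (O : rel V) (x : V -> R) (a b : {set V} -> R) (f : 'I_#|V| -> V)
    : 'M[R[i]]_#|V| :=
  \matrix_(i, j) adjacency_entry G O x a b (f i) (f j).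

Lemma loop_seq_size_gt0 (V : finType) (G : dicot V) (s : labelled_seq V) :
  is_loop_seq G s -> (0 < #|V|)%N.
Proof. by case/and4P=> s_gt0 _ _ _; apply: leq_trans s_gt0 (size_bseq s). Qed.

Lemma rotations_refl (V : finType) (G : dicot V) (s : labelled_seq V) :
  is_loop_seq G s -> s \in rotations s.
Proof.
move=> /loop_seq_size_gt0 V_gt0; apply/imsetP.
by exists (Ordinal V_gt0) => //; apply/val_inj; rewrite /= rot0.
Qed.

Lemma seq_weight_rot (R : realType) (V : finType) (O : rel V)
    (a b : {set V} -> R) (n : nat) (s : seq (V * bool)) :
  uniq (seq_vertices s) -> seq_weight O a b (rot n s) = seq_weight O a b s.
Proof.
move=> s_uniq; rewrite /seq_weight (perm_big s) /=; last first.
  by rewrite perm_rot.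
congr (- _); apply: eq_bigr => p _.
by rewrite /seq_vertices map_rot next_rot.
Qed.

Lemma loop_weightE (R : realType) (V : finType) (G : dicot V) (O : rel V)
    (a b : {set V} -> R) (s : labelled_seq V) :
  is_loop_seq G s -> loop_weight O a b (rotations s) = seq_weight O a b s.
Proof.
move=> loop_s; have /and4P[_ _ s_uniq _] := loop_s.
rewrite /loop_weight; case: pickP => [t /imsetP[i _ ->]|/(_ s)] /=.
  exact: seq_weight_rot.
by rewrite (rotations_refl loop_s).
Qed.

(* Main.v *)
(** Expanding each entry of K as solid part plus dashed part writes det K as a
    signed sum over permutations of V together with a choice of edge kind at
    every vertex.  Bipartiteness makes every nontrivial cycle even, so reversing
    a cycle multiplies its weight by (-1)^(number of dashed edges): reversing
    one cycle with an odd number of dashed edges is a sign-reversing involution,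
    and such terms cancel.  The remaining terms correspond to the monopole-dimer
    configurations, the fixed points being the isolated vertices and the
    nontrivial (even) cycles, each of sign -1, being the loops. *)
Require Import Defs.
From mathcomp Require Import all_boot all_order all_algebra all_fingroup.
From mathcomp Require Import reals complex.
Set Implicit Arguments.
Unset Strict Implicit.
Unset Printing Implicit Defensive.
Import GRing.Theory Num.Theory.
Local Open Scope ring_scope.

(** * Orbits of a permutation, and determinants over an arbitrary finite index type *)

Lemma mem_porbit_perm (T : finType) (s : {perm T}) (x y : T) :
  (s y \in porbit s x) = (y \in porbit s x).
Proof.
by rewrite -!eq_porbit_mem (porbit_perm s 1 y).
Qed.

Lemma mem_porbits_perm (T : finType) (s : {perm T}) (P : {set T}) (y : T) :
  P \in porbits s -> (s y \in P) = (y \in P).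
Proof. by case/imsetP=> x _ ->; apply: mem_porbit_perm. Qed.

Lemma mem_porbits_permV (T : finType) (s : {perm T}) (P : {set T}) (y : T) :
  P \in porbits s -> (s^-1 y \in P)%g = (y \in P).
Proof. by rewrite -porbitsV; apply: mem_porbits_perm. Qed.

Lemma porbits_porbit (T : finType) (s : {perm T}) (P : {set T}) (x : T) :
  P \in porbits s -> x \in P -> P = porbit s x.
Proof.
by case/imsetP=> y _ -> yx; apply/eqP; rewrite eq_porbit_mem porbit_sym.
Qed.

Lemma porbits_partition (T : finType) (s : {perm T}) :
  partition (porbits s) [set: T].
Proof.
apply/and3P; split.
- apply/eqP/setP=> x; rewrite inE; apply/bigcupP.
  by exists (porbit s x); [apply: imset_f | apply: porbit_id].
- apply/trivIsetP=> P Q sP sQ; apply: contraR => /pred0Pn[x /andP[/= xP xQ]].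
  by rewrite (porbits_porbit sP xP) (porbits_porbit sQ xQ).
- by apply/imsetP=> -[x _ /setP/(_ x)]; rewrite porbit_id inE.
Qed.

(** Since [t] keeps its iterates inside [A], where [s] and [t] agree, induction shows that both
    permutations have the same iterates from [x]. *)
Lemma porbit_eq_in (T : finType) (s t : {perm T}) (A : {set T}) (x : T) :
    (forall y, y \in A -> s y = t y) -> (forall y, y \in A -> t y \in A) ->
  x \in A -> porbit s x = porbit t x.
Proof.
move=> st tA xA.
have iterA i : ((t ^+ i)%g x \in A) /\ ((s ^+ i)%g x = (t ^+ i)%g x).
  elim: i => [|i [IHA IHst]]; first by rewrite !expg0 perm1.
  by rewrite !expgSr !permM IHst st ?tA.
by apply/setP=> y; apply/porbitP/porbitP=> -[i ->]; exists i;
  rewrite (iterA i).2.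
Qed.

Lemma porbit1 (T : finType) (s : {perm T}) (x : T) :
  (#|porbit s x| == 1%N) = (s x == x).
Proof.
apply/idP/eqP=> [/cards1P[y xy]|sx].
  have := mem_porbit_perm s x x; have := porbit_id s x.
  by rewrite xy !inE => /eqP->; rewrite eqxx => /eqP.
rewrite (_ : porbit s x = [set x]) ?cards1 //; apply/setP=> y; rewrite inE.
apply/porbitP/eqP=> [[i ->]|->]; last by exists 0%N; rewrite expg0 perm1.
by elim: i => [|i IHi]; rewrite ?expg0 ?perm1 // expgSr permM IHi.
Qed.

(* A cycle of length n has sign (-1)^(n-1), and absorbing one factor -1 per
   point of the cycle leaves the uniform sign -1 per cycle. *)
Lemma perm_term_porbits (C : comNzRingType) (T : finType) (s : {perm T})
    (F : T -> C) :
  (-1) ^+ s * \prod_x F x = \prod_(P in porbits s) (- \prod_(x in P) - F x).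
Proof.
rewrite prodrN.
rewrite -(big_trivIset _ (partition_trivIset (porbits_partition s))) /=.
rewrite (cover_partition (porbits_partition s)).
rewrite [\prod_(x in [set: T]) _]prodrN cardsT mulrA.
congr (_ * _); last by apply: eq_bigl => x; rewrite inE.
by rewrite /odd_perm signr_addb !signr_odd mulrC.
Qed.

(** Conjugation by [f] identifies the permutations of the ordinals, over which [determinant] sums,
    with those of [T]; this also shows that the chosen order of the vertices is irrelevant. *)
Lemma det_perm_reindex (C : comNzRingType) (T : finType) (f : 'I_#|T| -> T)
    (M : T -> T -> C) :
    bijective f ->
  \det (\matrix_(i, j) M (f i) (f j)) =
    \sum_(s : {perm T}) (-1) ^+ s * \prod_x M x (s x).
Proof.
case=> g fK gK.
have fbij : bijective f by exists g.
have conj_inj (s : 'S_#|T|) : injective (f \o s \o g).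
  exact/inj_comp/(can_inj gK)/inj_comp/perm_inj/(can_inj fK).
have conjV_inj (s : {perm T}) : injective (g \o s \o f).
  exact/inj_comp/(can_inj fK)/inj_comp/perm_inj/(can_inj gK).
pose c s : {perm T} := perm (conj_inj s).
have cM : {morph c : s t / (s * t)%g}.
  by move=> s t; apply/permP=> x; rewrite permM !permE /= permE /= fK.
have c1 : c 1%g = 1%g by apply/permP=> x; rewrite permE /= !perm1 gK.
have cT (t : 'I_#|T| * 'I_#|T|) : c (tperm t.1 t.2) = tperm (f t.1) (f t.2).
  apply/permP=> x; rewrite permE /= -[in RHS](gK x) !permE /=.
  by rewrite !(inj_eq (can_inj fK)); do 2!case: ifP => // _.
(* The sign survives conjugation because a product of nontrivial transpositions is carried to a
   product of as many nontrivial transpositions. *)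
have c_odd s : (c s : bool) = s.
  have [ts -> dts] := prod_tpermP s.
  rewrite (big_morph c cM c1) (odd_perm_prod dts).
  rewrite -(size_map (fun t => (f t.1, f t.2))) -odd_perm_prod.
    by rewrite big_map; congr odd_perm; apply: eq_bigr => t _; apply: cT.
  rewrite all_map; apply: sub_all dts => t.
  by rewrite /dpair /= (inj_eq (can_inj fK)).
rewrite /determinant (reindex c) /=; last first.
  exists (fun s => perm (conjV_inj s)) => s _; apply/permP=> x;
    by rewrite !permE /= !permE /= ?fK ?gK.
apply: eq_bigr => s _; rewrite c_odd; congr (_ * _).
rewrite (reindex f) /=; last exact: onW_bij.
by apply: eq_bigr => i _; rewrite mxE permE /= fK.
Qed.

(** * Labelled permutations and the reversal of one orbit *)

Notation labelled_perm V := ({perm V} * {ffun V -> bool})%type.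

(* [p.2 v] is the kind of the edge from [v] to [p.1 v]; it is forced to be
   [false] when [v] is fixed, a vertex weight being a single term. *)
Definition valid (V : finType) (G : dicot V) (p : labelled_perm V) : bool :=
  [forall v, if p.1 v == v then ~~ p.2 v
             else [set v; p.1 v] \in edges G (p.2 v)].

Definition dashed_odd (V : finType) (p : labelled_perm V) (P : {set V})
    : bool :=
  odd #|[set v in P | p.2 v]|.

(** [restr_perm P p.1] acts as [p.1] on an orbit [P] and trivially elsewhere, so composing [p.1]
    with its inverse square inverts [p.1] on [P] only. The edge now leaving [v] is the one that used
    to enter it, hence the label is read at the predecessor of [v]. *)
Definition reverse (V : finType) (P : {set V}) (p : labelled_perm V)
    : labelled_perm V :=
  ((p.1 * restr_perm P p.1 ^- 2)%g,
   [ffun v => if v \in P then p.2 ((p.1)^-1%g v) else p.2 v]).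

Lemma reverse_in (V : finType) (P : {set V}) (p : labelled_perm V) (v : V) :
  P \in porbits p.1 -> v \in P -> (reverse P p).1 v = (p.1^-1)%g v.
Proof.
move=> pP vP; rewrite permM.
have nP : p.1 \in ('N(P | 'P))%g.
  by apply/astabsP=> w; apply: mem_porbits_perm.
have rE w : w \in P -> (restr_perm P p.1 w) = p.1 w by apply: restr_permE.
have uP : (p.1^-1)%g v \in P by rewrite mem_porbits_permV.
apply: (canLR (permK _)); rewrite expgS expg1 permM !rE //; last first.
  by rewrite mem_porbits_perm.
by rewrite permKV.
Qed.

Lemma reverse_out (V : finType) (P : {set V}) (p : labelled_perm V) (v : V) :
  P \in porbits p.1 -> v \notin P -> (reverse P p).1 v = p.1 v.
Proof.
move=> pP vP; rewrite permM.
have sP : p.1 v \notin P by rewrite mem_porbits_perm.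
have rE := out_perm (restr_perm_on P p.1) sP.
by apply: (canLR (permK _)); rewrite expgS expg1 permM !rE.
Qed.

(** The reversed permutation is compared with the inverse of [p.1] on [P], and with [p.1] itself on
    the complement; a permutation and its inverse have the same orbits. *)
Lemma reverse_porbit (V : finType) (P : {set V}) (p : labelled_perm V) :
  P \in porbits p.1 -> porbit (reverse P p).1 =1 porbit p.1.
Proof.
move=> pP v; have [vP|vP] := boolP (v \in P).
  rewrite -[RHS]porbitV; apply: (porbit_eq_in (A := P)) => // w wP.
    exact: reverse_in.
  by rewrite mem_porbits_permV.
apply: (porbit_eq_in (A := ~: P)); rewrite ?inE // => w; rewrite !inE => wP.
  exact: reverse_out.
by rewrite mem_porbits_perm.
Qed.

Lemma reverse_porbits (V : finType) (P : {set V}) (p : labelled_perm V) :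
  P \in porbits p.1 -> porbits (reverse P p).1 = porbits p.1.
Proof. by move=> pP; apply: eq_imset; apply: reverse_porbit. Qed.

Lemma reverseK (V : finType) (P : {set V}) (p : labelled_perm V) :
  P \in porbits p.1 -> reverse P (reverse P p) = p.
Proof.
move=> pP; have rP : P \in porbits (reverse P p).1 by rewrite reverse_porbits.
have rV v : v \in P -> ((reverse P p).1^-1)%g v = p.1 v.
  by move=> vP; apply: (canLR (permK _));
    rewrite reverse_in ?mem_porbits_perm ?permK.
apply/eqP; rewrite -pair_eqE; apply/andP; split; apply/eqP.
  apply/permP=> v; have [vP|vP] := boolP (v \in P).
    by rewrite reverse_in // rV.
  by rewrite !reverse_out.
apply/ffunP=> v; rewrite ffunE; case: ifP => vP.
  by rewrite rV // ffunE mem_porbits_perm // vP permK.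
by rewrite ffunE vP.
Qed.

(** On [P] reversal only shifts the labels by the injection [p.1], which preserves their count; any
    other orbit is disjoint from [P] and keeps its labels. *)
Lemma reverse_dashed_odd (V : finType) (P Q : {set V}) (p : labelled_perm V) :
  P \in porbits p.1 -> Q \in porbits p.1 ->
  dashed_odd (reverse P p) Q = dashed_odd p Q.
Proof.
move=> pP pQ; rewrite /dashed_odd; congr odd.
have [->|nPQ] := eqVneq Q P.
  rewrite -[RHS](card_imset _ (@perm_inj _ p.1)); apply: eq_card => v.
  rewrite !inE ffunE; apply/andP/imsetP=> [[vP]|[w]].
    rewrite vP => kv; exists (p.1^-1 v)%g; last by rewrite permKV.
    by rewrite inE mem_porbits_permV // vP.
  by rewrite inE => /andP[wP kw] ->; rewrite mem_porbits_perm // wP permK.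
apply: eq_card => v; rewrite !inE ffunE; case: (boolP (v \in Q)) => //= vQ.
case: ifP => // vP; case/eqP: nPQ.
by rewrite (porbits_porbit pP vP) (porbits_porbit pQ vQ).
Qed.

Lemma valid_edge (V : finType) (G : dicot V) (p : labelled_perm V) (v : V) :
  valid G p -> p.1 v != v -> [set v; p.1 v] \in edges G (p.2 v).
Proof. by move=> /forallP/(_ v) + /negPf nv; rewrite nv. Qed.

Lemma valid_fixed (V : finType) (G : dicot V) (p : labelled_perm V) (v : V) :
  valid G p -> p.1 v = v -> p.2 v = false.
Proof. by move=> /forallP/(_ v) + pv; rewrite pv eqxx => /negPf. Qed.

Lemma reverse_valid (V : finType) (G : dicot V) (P : {set V})
    (p : labelled_perm V) :
  P \in porbits p.1 -> valid G p -> valid G (reverse P p).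
Proof.
move=> pP p_ok; apply/forallP=> v; rewrite ffunE.
have [vP|vP] := boolP (v \in P).
  rewrite reverse_in //; set u := (p.1^-1)%g v.
  have -> : v = p.1 u by rewrite permKV.
  rewrite setUC eq_sym.
  by case: ifPn => [/eqP/(valid_fixed p_ok)->|/(valid_edge p_ok)].
by rewrite reverse_out //; have /forallP := p_ok.
Qed.

(** * Parity of orbits and weights of labelled permutations *)

Lemma dicot_col (V : finType) (G : dicot V) :
  exists col : V -> bool,
    forall u v k, [set u; v] \in edges G k -> col v = ~~ col u.
Proof.
have [col colP] := dicot_bipartite G; exists col => u v k uv.
have /colP : [set u; v] \in solid G :|: dashed G.
  by rewrite inE; case: k uv => /= ->; rewrite ?orbT.
by case: (col u) (col v) => -[].
Qed.

(** Every step along a nontrivial orbit flips the colour, so [p.1] maps the vertices of one colour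
    in [P] bijectively onto those of the other. *)
Lemma valid_porbit_even (V : finType) (G : dicot V) (p : labelled_perm V)
    (P : {set V}) :
  valid G p -> P \in porbits p.1 -> #|P| != 1%N -> ~~ odd #|P|.
Proof.
move=> p_ok pP nP1; have [col colP] := dicot_col G.
have flip v : v \in P -> col (p.1 v) = ~~ col v.
  move=> vP; apply: (colP v (p.1 v) (p.2 v)); apply: valid_edge => //.
  by rewrite -porbit1 -(porbits_porbit pP vP).
rewrite -(cardsID [set v | col v] P).
suff <- : #|P :&: [set v | col v]| = #|P :\: [set v | col v]|.
  by rewrite addnn odd_double.
rewrite -(card_imset _ (@perm_inj _ p.1)); apply: eq_card => v.
rewrite !inE; apply/imsetP/andP=> [[u]|[nv vP]].
  by rewrite !inE => /andP[uP cu] ->; rewrite mem_porbits_perm // flip // cu.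
have uP : (p.1^-1 v)%g \in P by rewrite mem_porbits_permV.
exists (p.1^-1 v)%g; last by rewrite permKV.
by rewrite !inE uP; move: nv; rewrite -{1}(permKV p.1 v) flip // negbK.
Qed.

Lemma dashed_odd_nontrivial (V : finType) (G : dicot V) (p : labelled_perm V)
    (P : {set V}) :
  valid G p -> P \in porbits p.1 -> dashed_odd p P -> #|P| != 1%N.
Proof.
move=> p_ok pP; apply: contraTneq => P1.
rewrite /dashed_odd (_ : [set v in P | p.2 v] = set0) ?cards0 //.
apply/setP=> v; rewrite !inE; case: (boolP (v \in P)) => //= vP.
apply: valid_fixed p_ok _; apply/eqP.
by rewrite -porbit1 -(porbits_porbit pP vP) P1.
Qed.

(** One of the two summands of a matrix entry. It vanishes when there is no edge of kind [k], so
    labels may range freely over all functions, and a diagonal entry is carried entirely by the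
    label [false]. *)
Definition arc_weight (R : realType) (V : finType) (G : dicot V) (O : rel V)
    (x : V -> R) (a b : {set V} -> R) (u : V) (k : bool) (v : V) : R[i] :=
  if u == v then if k then 0 else ((x u)%:C)%C
  else if [set u; v] \in edges G k then step_weight O a b u k v else 0.

Definition perm_weight (R : realType) (V : finType) (G : dicot V) (O : rel V)
    (x : V -> R) (a b : {set V} -> R) (p : labelled_perm V) : R[i] :=
  (-1) ^+ p.1 * \prod_v arc_weight G O x a b v (p.2 v) (p.1 v).

Lemma adjacency_entryE (R : realType) (V : finType) (G : dicot V) (O : rel V)
    (x : V -> R) (a b : {set V} -> R) (u v : V) :
    is_orientation G O ->
  adjacency_entry G O x a b u v = \sum_k arc_weight G O x a b u k v.
Proof.
move=> [Osolid Oone]; rewrite big_bool /adjacency_entry /arc_weight /=.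
case: ifP => _; first by rewrite add0r.
rewrite addrC /dashed_entry /step_weight /solid_entry; congr (_ + _).
  case: (boolP (_ \in solid G)) => uv.
    by have := Oone _ _ uv; case: (O v u) => /= ->; rewrite ?rmorphN.
  rewrite !ifN //; first by apply: contra uv => /Osolid; rewrite setUC.
  by apply: contra uv => /Osolid.
by case: ifP => // _; rewrite mulr0.
Qed.

(** Off the diagonal, the solid part of the matrix is antisymmetric by the orientation and the
    dashed part is symmetric. *)
Lemma arc_weight_rev (R : realType) (V : finType) (G : dicot V) (O : rel V)
    (x : V -> R) (a b : {set V} -> R) (u v : V) (k : bool) :
    is_orientation G O -> u != v ->
  arc_weight G O x a b v k u = (-1) ^+ (~~ k) * arc_weight G O x a b u k v.
Proof.
move=> [Osolid Oone] nuv; rewrite /arc_weight eq_sym (negPf nuv) setUC.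
case: ifP => uv; last by rewrite mulr0.
rewrite /step_weight [_ |: _]setUC; case: k uv => /= uv.
  by rewrite expr0 mul1r.
rewrite expr1 mulN1r (Oone _ _ uv); case: (O v u) => //=.
by rewrite opprK.
Qed.

Lemma perm_weight_invalid (R : realType) (V : finType) (G : dicot V)
    (O : rel V) (x : V -> R) (a b : {set V} -> R) (p : labelled_perm V) :
  ~~ valid G p -> perm_weight G O x a b p = 0.
Proof.
case/forallPn=> v pv; rewrite /perm_weight (bigD1 v) //= {1}/arc_weight.
move: pv; rewrite (eq_sym v); case: ifP => _.
  by case: (p.2 v); rewrite //= mul0r mulr0.
by move=> /negPf->; rewrite mul0r mulr0.
Qed.

(** The sign is unchanged because it depends only on the number of orbits, so the effect comes from
    the solid edges of [P], each of which contributes -1. Their number is the even size of [P] minus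
    an odd number of dashed edges, hence odd. *)
Lemma perm_weight_reverse (R : realType) (V : finType) (G : dicot V)
    (O : rel V) (x : V -> R) (a b : {set V} -> R) (P : {set V})
    (p : labelled_perm V) :
    is_orientation G O -> valid G p -> P \in porbits p.1 -> dashed_odd p P ->
  perm_weight G O x a b (reverse P p) = - perm_weight G O x a b p.
Proof.
move=> hO p_ok pP oddP; rewrite /perm_weight -mulrN.
have -> : ((reverse P p).1 : bool) = p.1 by rewrite /odd_perm reverse_porbits.
congr (_ * _); rewrite (bigID (mem P)) [in RHS](bigID (mem P)) /= -mulNr.
congr (_ * _); last first.
  by apply: eq_bigr => v vP; rewrite reverse_out // ffunE (negPf vP).
have P1 := dashed_odd_nontrivial p_ok pP oddP.
(* After this shift, the factor of the reversed product indexed by [v] is the edge from [p.1 v] back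
   to [v], which faces the edge from [v] to [p.1 v] on the other side. *)
rewrite (reindex_inj (@perm_inj _ p.1)) /=.
under eq_bigl do rewrite mem_porbits_perm //.
transitivity (\prod_(v in P) ((-1) ^+ (~~ p.2 v)
                              * arc_weight G O x a b v (p.2 v) (p.1 v))).
  apply: eq_bigr => v vP.
  rewrite reverse_in ?mem_porbits_perm // ffunE mem_porbits_perm // vP !permK.
  by rewrite arc_weight_rev // eq_sym -porbit1 -(porbits_porbit pP vP).
rewrite big_split /= -[RHS]mulN1r; congr (_ * _).
rewrite prodrXr -signr_odd.
have -> : (\sum_(v in P) ~~ p.2 v = #|P :\: [set v | p.2 v]|)%N.
  rewrite -sum1_card big_mkcond [in RHS]big_mkcond.
  by apply: eq_bigr => v _; rewrite !inE; case: (v \in P); case: (p.2 v).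
have := valid_porbit_even p_ok pP P1.
rewrite -(cardsID [set v | p.2 v] P) oddD.
have -> : P :&: [set v | p.2 v] = [set v in P | p.2 v].
  by apply/setP=> v; rewrite !inE.
by rewrite [odd _]oddP /= negbK => ->.
Qed.

(** * Cancellation of the terms having an orbit with an odd number of dashed edges *)

Definition has_odd (V : finType) (p : labelled_perm V) : bool :=
  [exists P in porbits p.1, dashed_odd p P].

(* Reversal changes neither the set of orbits nor the parity of their numbers of
   dashed edges, so the same orbit is picked again and this is an involution. *)
Definition reverse_pick (V : finType) (p : labelled_perm V)
    : labelled_perm V :=
  if [pick P in porbits p.1 | dashed_odd p P] is Some P then reverse P p else p.

Lemma reverse_pickP (V : finType) (p : labelled_perm V) :
  has_odd p -> exists P, [/\ P \in porbits p.1, dashed_odd p P,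
    reverse_pick p = reverse P p & reverse_pick (reverse P p) = p].
Proof.
move=> /exists_inP[Q pQ oddQ]; rewrite {1}/reverse_pick.
case pickE: [pick P in porbits p.1 | dashed_odd p P] => [P|]; last first.
  by move: pickE; case: pickP => // /(_ Q); rewrite pQ oddQ.
have [pP oddP] : P \in porbits p.1 /\ dashed_odd p P.
  by move: pickE; case: pickP => // S /andP[pS oddS] [<-].
exists P; split=> //; rewrite /reverse_pick.
rewrite (_ : pick _ = Some P) ?reverseK // -pickE; apply: eq_pick => S /=.
rewrite reverse_porbits //; case: (boolP (S \in _)) => //= pS.
exact: reverse_dashed_odd.
Qed.

Lemma has_odd_reverse (V : finType) (P : {set V}) (p : labelled_perm V) :
  P \in porbits p.1 -> dashed_odd p P -> has_odd (reverse P p).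
Proof.
move=> pP oddP; apply/exists_inP; exists P; first by rewrite reverse_porbits.
by rewrite reverse_dashed_odd.
Qed.

Lemma det_even (R : realType) (V : finType) (G : dicot V) (O : rel V)
    (x : V -> R) (a b : {set V} -> R) (f : 'I_#|V| -> V) :
    is_orientation G O -> bijective f ->
  \det (adjacency_matrix G O x a b f) =
    \sum_(p : labelled_perm V | valid G p && ~~ has_odd p)
      perm_weight G O x a b p.
Proof.
move=> hO f_bij; rewrite /adjacency_matrix det_perm_reindex //.
transitivity (\sum_(p | valid G p) perm_weight G O x a b p).
  rewrite [RHS]big_mkcond /=.
  transitivity (\sum_s \sum_k perm_weight G O x a b (s, k)).
    apply: eq_bigr => s _.
    rewrite (eq_bigr _ (fun v _ => adjacency_entryE x a b v (s v) hO)).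
    by rewrite bigA_distr_bigA big_distrr.
  rewrite pair_big; apply: eq_bigr => -[s k] _ /=; case: ifPn => // p_bad.
  exact: perm_weight_invalid p_bad.
rewrite (bigID (@has_odd V)) /= -[RHS]add0r; congr (_ + _).
(* The sum over terms with an odd orbit is shown to equal its own opposite, through the involution
   [reverse_pick]; hence it is zero. *)
apply/eqP; rewrite -eqNr -sumrN; apply/eqP.
rewrite [RHS](reindex_onto (@reverse_pick V) (@reverse_pick V)) /=; last first.
  by move=> p /andP[_ /reverse_pickP[P [_ _ -> ->]]].
apply: eq_big => [p|p /andP[p_ok p_odd]].
  apply/andP/andP=> [[p_ok p_odd]|[/andP[rp_ok rp_odd]]].
    have [P [pP oddP rE rK]] := reverse_pickP p_odd.
    by rewrite rE rK eqxx reverse_valid // has_odd_reverse.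
  have [P [pP oddP -> _]] := reverse_pickP rp_odd.
  by move=> /eqP <-; rewrite reverse_valid ?has_odd_reverse.
have [P [pP oddP -> _]] := reverse_pickP p_odd.
by rewrite (perm_weight_reverse x a b hO p_ok).
Qed.

(** * Loops traced by a labelled permutation *)

Lemma orbit_porbit (T : finType) (s : {perm T}) (x : T) :
  fingraph.orbit s x =i porbit s x.
Proof.
move=> y; rewrite -fconnect_orbit; apply/idP/porbitP=> [xy|[i ->]].
  by exists (findex s x y); rewrite permX iter_findex.
by rewrite permX fconnect_iter.
Qed.

(** [fingraph.orbit] is used rather than [porbit] because it lists the orbit in order of traversal,
    which a loop has to remember. *)
Definition cycle_seq (V : finType) (p : labelled_perm V) (v : V)
    : seq (V * bool) :=
  [seq (u, p.2 u) | u <- fingraph.orbit p.1 v].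

Lemma size_cycle_seq (V : finType) (p : labelled_perm V) (v : V) :
  (size (cycle_seq p v) <= #|V|)%N.
Proof. by rewrite size_map size_orbit max_card. Qed.

Definition cycle_bseq (V : finType) (p : labelled_perm V) (v : V)
    : labelled_seq V :=
  Bseq (size_cycle_seq p v).

(** All vertices of one orbit give the same class of rotations, so this image contains one loop per
    nontrivial orbit. *)
Definition config_of (V : finType) (p : labelled_perm V)
    : {set {set labelled_seq V}} :=
  [set rotations (cycle_bseq p v) | v in [set v | p.1 v != v]].

Lemma vertices_cycle_seq (V : finType) (p : labelled_perm V) (v : V) :
  seq_vertices (cycle_seq p v) = fingraph.orbit p.1 v.
Proof. by rewrite /seq_vertices -map_comp map_id. Qed.

Lemma next_cycle_seq (V : finType) (p : labelled_perm V) (v u : V) :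
  u \in porbit p.1 v -> next (seq_vertices (cycle_seq p v)) u = p.1 u.
Proof.
rewrite -orbit_porbit vertices_cycle_seq => uv; apply: nextE uv.
exact/cycle_orbit/perm_inj.
Qed.

Lemma vertices_cycle_uniq (V : finType) (p : labelled_perm V) (v : V) :
  uniq (seq_vertices (cycle_seq p v)).
Proof. by rewrite vertices_cycle_seq orbit_uniq. Qed.

Lemma size_cycle_seqE (V : finType) (p : labelled_perm V) (v : V) :
  size (cycle_seq p v) = #|porbit p.1 v|.
Proof.
rewrite size_map -(eq_card (orbit_porbit p.1 v)).
by apply/esym/card_uniqP/orbit_uniq.
Qed.

Lemma rot_rot_exists (T : Type) (i n : nat) (s : seq T) :
  exists j, rot i (rot n s) = rot j s.
Proof.
have [ns|/ltnW ns] := leqP (size s) n.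
  by exists i; rewrite (rot_oversize ns).
have [|/ltnW si] := leqP (size s) i.
  by rewrite -(size_rot n) => /rot_oversize ->; exists n.
by rewrite rot_add_mod //; eexists.
Qed.

(** Bounding the index by [#|V|] loses nothing: [rot] is the identity at any index not below the
    size of the sequence. *)
Lemma rotationsP (V : finType) (s t : labelled_seq V) :
  (0 < #|V|)%N ->
  reflect (exists i, t = rot i s :> seq _) (t \in rotations s).
Proof.
move=> V_gt0; apply: (iffP imsetP) => [[i _ ->]|[i tE]]; first by exists i.
have [ltiV|leVi] := ltnP i #|V|.
  by exists (Ordinal ltiV) => //; apply/val_inj.
exists (Ordinal V_gt0) => //; apply/val_inj; rewrite /= rot0 tE rot_oversize //.
exact: leq_trans (size_bseq s) leVi.
Qed.

Lemma rotations_rot (V : finType) (s t : labelled_seq V) (n : nat) :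
  t = rot n s :> seq _ -> rotations t = rotations s.
Proof.
(* With no vertices there are no rotation indices, and both sets are empty. *)
move=> tE; have [V0|V_gt0] := posnP #|V|.
  apply/setP=> u; apply/imsetP/imsetP=> -[i _ _];
    by have := ltn_ord i; rewrite {2}V0.
have sE : exists m, s = rot m t :> seq _.
  by exists (size (rot n s) - n)%N; rewrite tE -[RHS]/(rotr n (rot n s)) rotK.
apply/setP=> u; apply/rotationsP/rotationsP=> // -[i ->].
  by rewrite tE; apply: rot_rot_exists.
by have [m ->] := sE; apply: rot_rot_exists.
Qed.

(** If [p] follows [s], the cycle of [p] from [v] is [s] rotated to start at [v]. This serves both
    for changing the starting vertex of a cycle and for recovering the loops of a given
    configuration. *)
Lemma rotations_cycle (V : finType) (p : labelled_perm V) (s : labelled_seq V)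
    (v : V) :
    uniq (seq_vertices s) ->
    (forall q, q \in (s : seq _) ->
       p.1 q.1 = next (seq_vertices s) q.1 /\ p.2 q.1 = q.2) ->
  v \in seq_vertices s -> rotations (cycle_bseq p v) = rotations s.
Proof.
move=> s_uniq sp vs; apply: (rotations_rot (n := index v (seq_vertices s))).
rewrite /= /cycle_seq (fingraph.orbitE (p := seq_vertices s)) //; last first.
  apply: cycle_from_next => // _ /mapP[q qs ->].
  by rewrite /= (sp q qs).1.
rewrite map_rot -map_comp map_id_in // => q qs /=.
by rewrite (sp q qs).2 -surjective_pairing.
Qed.

Lemma cycle_seq_mem (V : finType) (p : labelled_perm V) (v : V) q :
  (q \in cycle_seq p v) = (q.1 \in porbit p.1 v) && (q.2 == p.2 q.1).
Proof.
apply/mapP/andP=> [[u uv ->]|[qv /eqP qp]] /=; first by rewrite -orbit_porbit.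
by exists q.1; rewrite ?orbit_porbit // -qp -surjective_pairing.
Qed.

Lemma rotations_cycle_eq (V : finType) (p : labelled_perm V) (u v : V) :
  u \in porbit p.1 v ->
  rotations (cycle_bseq p u) = rotations (cycle_bseq p v).
Proof.
move=> uv; apply: rotations_cycle => /=.
- exact: vertices_cycle_uniq.
- by move=> q; rewrite cycle_seq_mem => /andP[qv /eqP->];
    rewrite next_cycle_seq.
- by rewrite vertices_cycle_seq orbit_porbit.
Qed.

Lemma cycle_is_loop_seq (V : finType) (G : dicot V) (p : labelled_perm V)
    (v : V) :
  valid G p -> p.1 v != v -> is_loop_seq G (cycle_bseq p v).
Proof.
move=> p_ok pv; rewrite /is_loop_seq vertices_cycle_uniq size_cycle_seqE /=.
rewrite lt0n card_porbit_neq0 (valid_porbit_even p_ok) ?imset_f ?porbit1 //=.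
apply/allP=> q; rewrite cycle_seq_mem => /andP[qv /eqP->].
rewrite next_cycle_seq //; apply: valid_edge => //.
by rewrite -porbit1 -(eqP (etrans (eq_porbit_mem _ _ _) qv)) porbit1 in pv *.
Qed.

Lemma num_dashed_cycle (V : finType) (p : labelled_perm V) (v : V) :
  odd (num_dashed (cycle_seq p v)) = dashed_odd p (porbit p.1 v).
Proof.
rewrite /num_dashed count_map -size_filter /dashed_odd; congr odd.
rewrite -(card_uniqP _) ?filter_uniq ?orbit_uniq //.
by apply: eq_card => u; rewrite mem_filter !inE orbit_porbit andbC.
Qed.

Lemma rotations_even_dashed (V : finType) (s : labelled_seq V) :
  ~~ odd (num_dashed s) -> even_dashed (rotations s).
Proof.
move=> s_even; apply/forall_inP=> _ /imsetP[i _ ->].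
by rewrite /num_dashed /= /rot count_cat addnC -count_cat cat_take_drop.
Qed.

Lemma loop_vertices_rotations (V : finType) (s : labelled_seq V) :
  (0 < #|V|)%N -> loop_vertices (rotations s) = [set v in seq_vertices s].
Proof.
move=> V_gt0; apply/setP=> v; rewrite inE; apply/bigcupP/idP=> [[t]|vs].
  by move=> /imsetP[i _ ->]; rewrite inE /seq_vertices /= map_rot mem_rot.
by exists s; rewrite ?inE //; apply/rotationsP => //; exists 0%N; rewrite rot0.
Qed.

Lemma loop_vertices_cycle (V : finType) (p : labelled_perm V) (v : V) :
  loop_vertices (rotations (cycle_bseq p v)) = porbit p.1 v.
Proof.
rewrite loop_vertices_rotations; last by apply/card_gt0P; exists v.
by apply/setP=> u; rewrite inE vertices_cycle_seq orbit_porbit.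
Qed.

(** The absence of odd orbits gives the even number of dashed edges, and two loops sharing a vertex
    come from the same orbit, hence coincide. *)
Lemma config_of_is_config (V : finType) (G : dicot V) (p : labelled_perm V) :
  valid G p -> ~~ has_odd p -> is_config G (config_of p).
Proof.
move=> p_ok p_even; apply/andP; split.
  apply/forall_inP=> _ /imsetP[v pv ->]; rewrite inE in pv; apply/andP; split.
    by apply/existsP; exists (cycle_bseq p v); rewrite cycle_is_loop_seq /=.
  apply: rotations_even_dashed; rewrite num_dashed_cycle.
  apply: contra p_even => v_odd; apply/exists_inP; exists (porbit p.1 v) => //.
  exact: imset_f.
apply/forall_inP=> _ /imsetP[u _ ->]; apply/forall_inP=> _ /imsetP[v _ ->].
apply/implyP; apply: contraR => /pred0Pn[w /andP[/=]].
rewrite !loop_vertices_cycle => wu wv; apply/eqP/rotations_cycle_eq.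
by rewrite -eq_porbit_mem -(eqP (etrans (eq_porbit_mem _ _ _) wu))
  eq_porbit_mem.
Qed.

(** The cycle of [p] through [v] is a rotation of some cycle of [q]; rotation preserves labels and
    cyclic successors, so both can be read off at [v]. *)
Lemma config_of_eq (V : finType) (p q : labelled_perm V) (v : V) :
    config_of p = config_of q -> p.1 v != v ->
  p.1 v = q.1 v /\ p.2 v = q.2 v.
Proof.
move=> pq pv; have V_gt0 : (0 < #|V|)%N by apply/card_gt0P; exists v.
have : rotations (cycle_bseq p v) \in config_of q.
  by rewrite -pq; apply: imset_f; rewrite inE.
case/imsetP=> w _ rE.
have : cycle_bseq p v \in rotations (cycle_bseq q w).
  by rewrite -rE; apply/rotationsP => //; exists 0%N; rewrite rot0.
case/(rotationsP _ _ V_gt0)=> i /= cE.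
have : (v, p.2 v) \in cycle_seq p v by rewrite cycle_seq_mem /= porbit_id eqxx.
rewrite {1}cE mem_rot cycle_seq_mem /= => /andP[vw /eqP ->]; split=> //.
rewrite -(next_cycle_seq (porbit_id p.1 v)) cE /seq_vertices map_rot.
by rewrite next_rot ?vertices_cycle_uniq // next_cycle_seq.
Qed.

Lemma config_of_inj (V : finType) (G : dicot V) (p q : labelled_perm V) :
  valid G p -> valid G q -> config_of p = config_of q -> p = q.
Proof.
move=> p_ok q_ok pq.
have agree v : p.1 v = q.1 v /\ p.2 v = q.2 v.
  have [pv|pv] := eqVneq (p.1 v) v; last exact: config_of_eq.
  have [qv|qv] := eqVneq (q.1 v) v; last first.
    by have [-> ->] := config_of_eq (esym pq) qv.
  by rewrite pv qv (valid_fixed p_ok pv) (valid_fixed q_ok qv).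
case: p q agree {p_ok q_ok pq} => [s k] [t l] /= agree.
by congr (_, _); [apply/permP | apply/ffunP] => v; case: (agree v).
Qed.

(** * Recovering a labelled permutation from a configuration *)

Lemma uniq_map_inj_in (T U : eqType) (f : T -> U) (s : seq T) :
  uniq (map f s) -> {in s &, injective f}.
Proof.
elim: s => //= z s IHs /andP[zs /IHs s_inj] x y; rewrite !inE.
case/predU1P=> [->|xs] /predU1P[->|ys] // fxy; last exact: s_inj.
  by case/negP: zs; rewrite fxy map_f.
by case/negP: zs; rewrite -fxy map_f.
Qed.

(** A representative of the loop through [v]. The default [[::]] suits isolated vertices, since
    [next] and [prev] on the empty sequence return their argument. *)
Definition loop_at (V : finType) (C : {set {set labelled_seq V}}) (v : V)
    : seq (V * bool) :=
  if [pick s in \bigcup_(L in C) L | v \in seq_vertices s] is Some s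
  then s : seq _ else [::].

Lemma loop_at_in (V : finType) (G : dicot V) (C : {set {set labelled_seq V}})
    (s : labelled_seq V) (v : V) :
    is_config G C -> is_loop_seq G s -> rotations s \in C ->
    v \in seq_vertices s ->
  exists i, loop_at C v = rot i s.
Proof.
move=> /andP[/forall_inP loopC /forall_inP disjC] loop_s sC vs.
have V_gt0 := loop_seq_size_gt0 loop_s.
rewrite /loop_at; case: pickP => [t|/(_ s)]; last first.
  rewrite vs andbT => /negP[]; apply/bigcupP; exists (rotations s) => //.
  exact: rotations_refl loop_s.
case/andP=> /bigcupP[L LC tL] vt; apply/rotationsP => //.
have [<- //|nL] := eqVneq L (rotations s).
have /forall_inP/(_ _ sC) := disjC L LC.
rewrite nL => /pred0P/(_ v); rewrite /= loop_vertices_rotations // inE vs andbT.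
by move/negP; case; apply/bigcupP; exists t; rewrite ?inE.
Qed.

Lemma loop_at_out (V : finType) (C : {set {set labelled_seq V}}) (v : V) :
  v \notin seq_vertices (loop_at C v) -> loop_at C v = [::].
Proof. by rewrite /loop_at; case: pickP => // s /andP[_ ->]. Qed.

Lemma loop_at_mem (V : finType) (G : dicot V) (C : {set {set labelled_seq V}})
    (v : V) :
    is_config G C -> v \in seq_vertices (loop_at C v) ->
  exists s : labelled_seq V, [/\ rotations s \in C, is_loop_seq G s,
    ~~ odd (num_dashed s) & v \in seq_vertices s].
Proof.
move=> /andP[/forall_inP loopC _]; rewrite /loop_at; case: pickP => // t.
case/andP=> /bigcupP[L LC tL] vt _.
have /andP[/existsP[s /andP[loop_s /eqP LE]]] := loopC L LC.
move=> /forall_inP evenL; exists s; rewrite -LE; split=> //.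
  by apply: evenL; rewrite LE (rotations_refl loop_s).
by move: tL vt; rewrite LE => /imsetP[i _ ->];
  rewrite /seq_vertices /= map_rot mem_rot.
Qed.

Lemma edge_neq (V : finType) (G : dicot V) (u v : V) (k : bool) :
  [set u; v] \in edges G k -> u != v.
Proof.
have E : [set u; v] \in edges G k -> #|[set u; v]| = 2.
  by case: k; [apply: card_dashed | apply: card_solid].
by move/E; rewrite cards2; case: eqP.
Qed.

Lemma loop_next_neq (V : finType) (G : dicot V) (s : seq (V * bool)) (v : V) :
  is_loop_seq G s -> v \in seq_vertices s -> next (seq_vertices s) v != v.
Proof.
case/and4P=> _ _ _ /allP edge_s /mapP[q qs ->].
by rewrite eq_sym; apply: edge_neq (edge_s q qs).
Qed.

(** The permutation sends each vertex to its successor on its loop and fixes the isolated vertices;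
    its inverse takes predecessors. *)
Lemma config_of_surj (V : finType) (G : dicot V)
    (C : {set {set labelled_seq V}}) :
    is_config G C ->
  exists p, [/\ valid G p, ~~ has_odd p & config_of p = C].
Proof.
move=> C_ok.
pose sg v := next (seq_vertices (loop_at C v)) v.
pose ta v := prev (seq_vertices (loop_at C v)) v.
have loopP (s : labelled_seq V) v : is_loop_seq G s -> rotations s \in C ->
    v \in seq_vertices s ->
    [/\ sg v = next (seq_vertices s) v, ta v = prev (seq_vertices s) v
      & loop_at C v =i s].
  move=> loop_s sC vs; have /and4P[_ _ s_uniq _] := loop_s.
  have [i iE] := loop_at_in C_ok loop_s sC vs.
  rewrite /sg /ta iE /seq_vertices map_rot next_rot // prev_rot //.
  by split=> // q; rewrite mem_rot.
have sgK : cancel sg ta.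
  move=> v.
  have [vC|vC] := boolP (v \in seq_vertices (loop_at C v)); last first.
    by rewrite /ta /sg (loop_at_out vC) /= (loop_at_out vC).
  have [s [sC loop_s _ vs]] := loop_at_mem C_ok vC.
  have /and4P[_ _ s_uniq _] := loop_s.
  have [-> _ _] := loopP s v loop_s sC vs.
  have nvs : next (seq_vertices s) v \in seq_vertices s by rewrite mem_next.
  by have [_ -> _] := loopP s _ loop_s sC nvs; apply: prev_next.
(* An isolated vertex has an empty [loop_at], so it receives the label [false] that [valid]
   demands. *)
pose p : labelled_perm V :=
  (perm (can_inj sgK), [ffun v => (v, true) \in loop_at C v]).
have pP (s : labelled_seq V) : is_loop_seq G s -> rotations s \in C ->
    forall q, q \in (s : seq _) ->
    p.1 q.1 = next (seq_vertices s) q.1 /\ p.2 q.1 = q.2.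
  move=> loop_s sC q qs; have /and4P[_ _ s_uniq _] := loop_s.
  have qv : q.1 \in seq_vertices s by apply: map_f.
  have [sgE _ lE] := loopP s q.1 loop_s sC qv.
  rewrite permE ffunE lE; split=> //.
  apply/idP/idP=> [q1s|q2]; last by rewrite -q2 -surjective_pairing.
  (* A vertex occurs only once in a loop, so it cannot carry both labels there. *)
  by have /(congr1 snd) := uniq_map_inj_in s_uniq q1s qs erefl => /= <-.
have pE v : p.1 v != v -> exists s : labelled_seq V,
    [/\ rotations s \in C, is_loop_seq G s, ~~ odd (num_dashed s),
      v \in seq_vertices s & rotations (cycle_bseq p v) = rotations s].
  rewrite permE => sv; have vC : v \in seq_vertices (loop_at C v).
    by apply: contraR sv => vC; rewrite /sg (loop_at_out vC).
  have [s [sC loop_s s_even vs]] := loop_at_mem C_ok vC.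
  exists s; split=> //; apply: rotations_cycle => //; last exact: pP.
  by have /and4P[] := loop_s.
have p_fixed v : p.1 v = v -> p.2 v = false.
  rewrite permE ffunE => sv; apply/negP=> /(map_f (fun q => q.1)) /= vC.
  have [s [sC loop_s _ vs]] := loop_at_mem C_ok vC.
  have [sE _ _] := loopP s v loop_s sC vs.
  by have := loop_next_neq loop_s vs; rewrite -sE sv eqxx.
have p_ok : valid G p.
  apply/forallP=> v; case: eqVneq => [/p_fixed -> //|/pE].
  case=> s [sC loop_s _ /mapP[q qs vE] _].
  have [p1 p2] := pP s loop_s sC q qs.
  have /and4P[_ _ _ /allP/(_ q qs)] := loop_s.
  by rewrite vE p1 p2.
exists p; split=> //.
  (* An odd orbit would be nontrivial, so its cycle would represent a loop of [C], all of whose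
     representatives have an even number of dashed edges. *)
  apply/negP=> /exists_inP[P pP' oddP].
  have := dashed_odd_nontrivial p_ok pP' oddP.
  case/imsetP: pP' oddP => v _ ->; rewrite porbit1 -num_dashed_cycle => oddv.
  have V_gt0 : (0 < #|V|)%N by apply/card_gt0P; exists v.
  case/pE=> s [_ _ s_even _ rE].
  have /forall_inP/(_ (cycle_bseq p v)) := rotations_even_dashed s_even.
  rewrite oddv => /implyP; rewrite implybF -rE => /negP; apply.
  by apply/rotationsP => //; exists 0%N; rewrite rot0.
apply/setP=> L; apply/imsetP/idP=> [[v]|LC].
  by rewrite inE => /pE[s [sC _ _ _ ->]] ->.
have /andP[/forall_inP/(_ L LC)/andP[/existsP[s /andP[loop_s /eqP LE]] _] _] :=
  C_ok.
rewrite LE in LC *; have /and4P[s_gt0 _ s_uniq _] := loop_s.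
have [q qs] : exists q, q \in (s : seq _).
  by case: (s : seq _) s_gt0 => // q t _; exists q; rewrite mem_head.
have qv : q.1 \in seq_vertices s by apply: map_f.
exists q.1; last by rewrite (rotations_cycle s_uniq) //; apply: pP.
by rewrite inE (pP s loop_s LC q qs).1 (loop_next_neq loop_s).
Qed.

(** * Agreement of the weights of configurations and of labelled permutations *)

Lemma isolated_config_of (V : finType) (p : labelled_perm V) :
  isolated (config_of p) = [set v | p.1 v == v].
Proof.
apply/setP=> v; rewrite !inE -[RHS]negbK; congr (~~ _).
apply/bigcupP/idP=> [[_ /imsetP[u + ->]]|pv].
  rewrite loop_vertices_cycle inE -!porbit1 -eq_porbit_mem => + /eqP vu.
  by rewrite vu.
exists (rotations (cycle_bseq p v)); first by apply: imset_f; rewrite inE.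
by rewrite loop_vertices_cycle porbit_id.
Qed.

(** Within one [config_of p] a loop is determined by its orbit; this lets a product over loops be
    rewritten as a product over nontrivial orbits. *)
Lemma loop_vertices_inj (V : finType) (p : labelled_perm V) :
  {in config_of p &, injective (@loop_vertices V)}.
Proof.
move=> K L /imsetP[u _ ->] /imsetP[v _ ->].
rewrite !loop_vertices_cycle => /eqP; rewrite eq_porbit_mem.
exact: rotations_cycle_eq.
Qed.

(** The orbit has even size, so the inner signs cancel; they are kept to match the form of
    [perm_term_porbits]. *)
Lemma loop_weight_cycle (R : realType) (V : finType) (G : dicot V)
    (O : rel V) (x : V -> R) (a b : {set V} -> R) (p : labelled_perm V)
    (v : V) :
    valid G p -> p.1 v != v ->
  loop_weight O a b (rotations (cycle_bseq p v)) =
    - \prod_(u in porbit p.1 v) - arc_weight G O x a b u (p.2 u) (p.1 u).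
Proof.
move=> p_ok pv; rewrite (loop_weightE _ _ _ (cycle_is_loop_seq p_ok pv)).
rewrite /seq_weight big_map big_uniq ?orbit_uniq //=; congr (- _).
rewrite prodrN -signr_odd (negPf (valid_porbit_even p_ok _ _)) ?imset_f;
  rewrite ?porbit1 //.
rewrite expr0 mul1r; apply: eq_big => [u|u]; first exact: orbit_porbit.
rewrite orbit_porbit => uv; rewrite next_cycle_seq // /arc_weight.
have pu : p.1 u != u
  by rewrite -porbit1 (eqP (etrans (eq_porbit_mem _ _ _) uv)) porbit1.
by rewrite eq_sym (negPf pu) valid_edge.
Qed.

Lemma config_weight_of (R : realType) (V : finType) (G : dicot V)
    (O : rel V) (x : V -> R) (a b : {set V} -> R) (p : labelled_perm V) :
  valid G p -> config_weight O x a b (config_of p) = perm_weight G O x a b p.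
Proof.
move=> p_ok; rewrite /perm_weight perm_term_porbits.
(* Orbits of size one yield the vertex weights, their two signs cancelling, and the other orbits
   yield the loop weights. *)
rewrite (bigID (fun P : {set V} => #|P| == 1%N)) /= mulrC /config_weight.
congr (_ * _); last first.
  rewrite isolated_config_of.
  transitivity (\prod_(P in [set [set v] | v in [set v | p.1 v == v]])
    (- \prod_(v in P) - arc_weight G O x a b v (p.2 v) (p.1 v))).
    rewrite big_imset => [|u v _ _] /=; last exact: set1_inj.
    apply: eq_bigr => v; rewrite inE => /eqP pv.
    by rewrite big_set1 opprK /arc_weight pv eqxx (valid_fixed p_ok).
  apply: eq_bigl => P; apply/imsetP/andP=> [[v]|[/imsetP[v _ ->]]].
    rewrite inE -porbit1 => pv ->; rewrite cards1; split=> //.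
    suff <- : porbit p.1 v = [set v] by apply: imset_f.
    have /cards1P[u vE] := pv.
    by have := porbit_id p.1 v; rewrite vE inE => /eqP ->.
  move=> pv; exists v; first by rewrite inE -porbit1.
  have /cards1P[u vE] := pv.
  by have := porbit_id p.1 v; rewrite vE inE => /eqP ->.
transitivity (\prod_(P in [set loop_vertices L | L in config_of p])
    (- \prod_(v in P) - arc_weight G O x a b v (p.2 v) (p.1 v))).
  rewrite [RHS]big_imset /=; last exact: loop_vertices_inj.
  apply: eq_bigr => _ /imsetP[v pv ->]; rewrite inE in pv.
  by rewrite loop_vertices_cycle (loop_weight_cycle O x a b p_ok).
apply: eq_bigl => P; apply/imsetP/andP=> [[_ /imsetP[v pv ->] ->]|].
  rewrite inE in pv; rewrite loop_vertices_cycle porbit1 pv; split=> //.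
  exact: imset_f.
case=> /imsetP[v _ ->]; rewrite porbit1 => pv.
exists (rotations (cycle_bseq p v)); last by rewrite loop_vertices_cycle.
by apply: imset_f; rewrite inE.
Qed.

Theorem theorem2p6 (R : realType) (V : finType) (G : dicot V) (O : rel V)
    (x : V -> R) (a b : {set V} -> R) (f : 'I_#|V| -> V)
    (hO : is_orientation G O)
    (x_gt0 : forall v : V, 0 < x v)
    (a_gt0 : forall e : {set V}, e \in solid G -> 0 < a e)
    (b_gt0 : forall e : {set V}, e \in dashed G -> 0 < b e)
    (f_bij : bijective f) :
  partition_function G O x a b = \det (adjacency_matrix G O x a b f).
Proof.
rewrite det_even // /partition_function.
(* [config_of] is a bijection from the valid labelled permutations without odd orbits onto the
   configurations: surjectivity and well-definedness are used here, injectivity in the reindexing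
   that follows. *)
transitivity (\sum_(C in [set config_of p
    | p in [set p : labelled_perm V | valid G p && ~~ has_odd p]])
      config_weight O x a b C).
  apply: eq_bigl => C; apply/idP/imsetP=> [/config_of_surj|[p + ->]].
    by case=> p [p_ok p_even <-]; exists p; rewrite ?inE ?p_ok.
  by rewrite inE => /andP[]; apply: config_of_is_config.
rewrite big_imset /= => [|p q]; last first.
  by rewrite !inE => /andP[p_ok _] /andP[q_ok _];
    apply: config_of_inj p_ok q_ok.
apply: eq_big => p; first by rewrite inE.
by rewrite inE => /andP[p_ok _]; apply: config_weight_of.
Qed.
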